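(* Let $a,b$ be nonzero real numbers, let $\mathcal{F}_n(a,b,x)$ be the bi-periodic Fibonacci matrix polynomials, let $\mathcal{A}_{n}(a,b,x)=\sqrt{x}\,a^{\varepsilon(n)/2}b^{(1-\varepsilon(n))/2}\mathcal{F}_{n}(a,b,x)$, let $k=x\sqrt{ab}$, and let $r_n(a,b,x)=\sum_{i=0}^{n}\binom{n}{i}k^{i}\mathcal{A}_i(a,b,x)$ be the rising $k$-binomial transform ($n\ge 0$). Then for every integer $n\ge 1$, $$r_{n+1}(a,b,x)=(abx^{2}+2)\,r_{n}(a,b,x)-r_{n-1}(a,b,x),$$ where $r_{0}(a,b,x)=\sqrt{bx}\,\mathcal{F}_{0}(a,b,x)$ and $r_{1}(a,b,x)=\sqrt{bx}\,\mathcal{F}_{0}(a,b,x)+ax\sqrt{bx}\,\mathcal{F}_{1}(a,b,x)$.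
   Context: Here $\varepsilon(n)=n-2\lfloor n/2\rfloor$ and $x$ is an indeterminate over $\mathbb{R}$; everything takes place in an algebraic closure of $\mathbb{R}(x)$, in which square roots $\sqrt a,\sqrt b,\sqrt x$ are fixed once and for all, with $\sqrt{ab}=\sqrt a\sqrt b$, $\sqrt{bx}=\sqrt b\sqrt x$, and half-integer powers of $a$ and $b$ are taken with respect to $\sqrt a,\sqrt b$. The bi-periodic Fibonacci matrix polynomials are the $2\times 2$ matrices defined by $\mathcal{F}_0(a,b,x)=\begin{pmatrix}1&0\\0&1\end{pmatrix}$, $\mathcal{F}_1(a,b,x)=\begin{pmatrix}bx&\frac{b}{a}\\1&0\end{pmatrix}$ and, for $n\ge 2$, $\mathcal{F}_n=ax\,\mathcal{F}_{n-1}+\mathcal{F}_{n-2}$ if $n$ is even, $\mathcal{F}_n=bx\,\mathcal{F}_{n-1}+\mathcal{F}_{n-2}$ if $n$ is odd. *)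

(* Defs.v *)
From mathcomp Require Import all_boot all_order all_algebra.
From mathcomp Require Import reals.

Set Implicit Arguments.
Unset Strict Implicit.
Unset Printing Implicit Defensive.

Import GRing.Theory.
Local Open Scope ring_scope.

Definition eps (n : nat) : nat := (n - 2 * (n %/ 2))%N.

Definition mx22 (T : Type) (u v w z : T) : 'M[T]_2 :=
  \matrix_(i < 2, j < 2)
    if i == 0 then (if j == 0 then u else v) else (if j == 0 then w else z).

Fixpoint biFibMx (R : realType) (a b : R) (n : nat) : 'M[{poly R}]_2 :=
  match n with
  | 0 => mx22 1 0 0 1
  | 1 => mx22 (b *: 'X) (b / a)%:P 1 0
  | (m.+1 as p).+1 =>
      ((if odd n then b else a) *: 'X) *: biFibMx a b p + biFibMx a b m
  end.

Section BinomialTransform.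

(* [L] stands for an algebraic closure of R(x), [f] for the inclusion of R(x)
   in it, and [sa], [sb], [sx] for the chosen square roots of a, b and x. *)
Variables (R : realType) (L : closedFieldType).
Variable f : {rmorphism {fraction {poly R}} -> L}.
Variables (a b : R) (sa sb sx : L).

Definition emb (p : {poly R}) : L := f (tofrac p).

Definition calF (n : nat) : 'M[L]_2 := map_mx emb (biFibMx a b n).

(* The half-integer powers a^(m/2) and b^(m/2) are [sa ^+ m] and [sb ^+ m];
   the natural-number subtraction is exact since eps n <= 1. *)
Definition calA (n : nat) : 'M[L]_2 :=
  (sx * sa ^+ eps n * sb ^+ (1 - eps n)) *: calF n.

(* sqrt (a b) is by convention [sa * sb]. *)
Definition kbin : L := emb 'X * (sa * sb).

Definition risingBinom (n : nat) : 'M[L]_2 :=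
  \sum_(i < n.+1) ('C(n, i)%:R * kbin ^+ i) *: calA i.

End BinomialTransform.

(* Main.v *)
Require Import Defs.
From mathcomp Require Import all_boot all_order all_algebra.
From mathcomp Require Import reals ring.

Set Implicit Arguments.
Unset Strict Implicit.
Unset Printing Implicit Defensive.

Import GRing.Theory.
Local Open Scope ring_scope.

(** The scaling by half-integer powers of a and b in the matrices A_n is chosen
    exactly so as to absorb the parity of the bi-periodic recurrence: since
    k * sqrt a = sqrt b * (a x) and k * sqrt b = sqrt a * (b x), the A_n satisfy
    the constant-coefficient recurrence A_(n+2) = k A_(n+1) + A_n
    ([calA_rec]).

    The rest holds for any sequence u with u_(n+2) = k u_(n+1) + u_n in a module.
    Let S be the shift of sequences. By the binomial theorem the rising
    k-binomial transform is r_n = ((1 + k S)^n u)_0. On u the shift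
    satisfies S^2 = k S + 1, so T = 1 + k S satisfies
    T^2 = 1 + 2 k S + k^2 (k S + 1) = (k^2 + 2) T - 1, whence
    r_(n+2) = (k^2 + 2) r_(n+1) - r_n ([binom_transform_rec]), and
    k^2 = a b x^2. *)

Section RisingBinomialTransform.

Variables (K : comNzRingType) (V : lmodType K) (k : K).

Definition binom_transform (u : nat -> V) (n : nat) : V :=
  \sum_(i < n.+1) ('C(n, i)%:R * k ^+ i) *: u i.

(** Pascal's rule, in the operator form (1 + k S)^(n+1) = (1 + k S)^n (1 + k S)
    with S the shift. *)
Lemma binom_transformS (u : nat -> V) (n : nat) :
  binom_transform u n.+1 =
    binom_transform u n + k *: binom_transform (fun i => u i.+1) n.
Proof.
rewrite /binom_transform big_ord_recl /= scaler_sumr.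
under eq_bigr => i _ do rewrite /bump add1n binS natrD mulrDl scalerDl.
rewrite big_split /= addrA; congr (_ + _).
  (* the summand of index n.+1 has coefficient 'C(n, n.+1) = 0 *)
  rewrite big_ord_recr /= (bin_small (ltnSn n)) mulr0n mul0r scale0r addr0.
  by rewrite [RHS]big_ord_recl /= !bin0.
by apply: eq_bigr => i _; rewrite scalerA exprS mulrCA.
Qed.

(** This is T^2 = (k^2 + 2) T - 1 for T = 1 + k S: the recurrence of u gives
    S^2 = k S + 1 ([shift2]), and k S = T - 1 ([shift1]) eliminates S. *)
Lemma binom_transform_rec (u : nat -> V) (n : nat) :
    (forall m, u m.+2 = k *: u m.+1 + u m) ->
  binom_transform u n.+2 =
    (k ^+ 2 + 2%:R) *: binom_transform u n.+1 - binom_transform u n.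
Proof.
move=> u_rec; pose Su i := u i.+1.
have shift2 : binom_transform (fun i => Su i.+1) n =
    k *: binom_transform Su n + binom_transform u n.
  rewrite /binom_transform scaler_sumr -big_split /=.
  apply: eq_bigr => i _.
  by rewrite /Su u_rec scalerDr !scalerA [k * _]mulrC.
have shift1 : k *: binom_transform Su n =
    binom_transform u n.+1 - binom_transform u n.
  by rewrite binom_transformS addrC addKr.
rewrite binom_transformS -/Su (binom_transformS Su) shift2 !scalerDr shift1.
rewrite !scalerBr !scalerA -expr2 subrK scalerDl scaler_nat mulr2n.
by rewrite [in LHS]addrA [LHS]addrC !addrA.
Qed.

End RisingBinomialTransform.

Section ScaledFibonacciMatrices.

Variables (R : realType) (L : closedFieldType).
Variable f : {rmorphism {fraction {poly R}} -> L}.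
Variables (a b : R) (sa sb sx : L).

Lemma embD : {morph emb f : p q / p + q}.
Proof. by move=> p q; rewrite /emb !rmorphD. Qed.

Lemma embM : {morph emb f : p q / p * q}.
Proof. by move=> p q; rewrite /emb !rmorphM. Qed.

Lemma embZ (c : R) (p : {poly R}) : emb f (c *: p) = emb f c%:P * emb f p.
Proof. by rewrite -mul_polyC embM. Qed.

Lemma eps_odd (n : nat) : eps n = odd n.
Proof. by rewrite /eps -modn2 {1}(divn_eq n 2) mulnC addKn. Qed.

Lemma biFibMx_rec (n : nat) :
  biFibMx a b n.+2 =
    ((if odd n then b else a) *: 'X) *: biFibMx a b n.+1 + biFibMx a b n.
Proof. by rewrite -[odd n]negbK. Qed.

Lemma calF_rec (n : nat) :
  calF f a b n.+2 =
    (emb f (if odd n then b else a)%:P * emb f 'X) *: calF f a b n.+1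
      + calF f a b n.
Proof.
by rewrite /calF biFibMx_rec; apply/matrixP=> i j; rewrite !mxE embD embM embZ.
Qed.

Hypothesis sa2 : sa ^+ 2 = emb f a%:P.
Hypothesis sb2 : sb ^+ 2 = emb f b%:P.

(** Consecutive terms are scaled by different square roots, and the root of a b
    in k swaps them: what is left over is a x or b x, according to the parity
    of n. *)
Lemma calA_rec (n : nat) :
  calA f a b sa sb sx n.+2 =
    kbin f sa sb *: calA f a b sa sb sx n.+1 + calA f a b sa sb sx n.
Proof.
rewrite /calA calF_rec !eps_odd /= negbK scalerDr !scalerA /kbin.
by congr (_ *: _ + _); case: (odd n) => /=; rewrite -?sa2 -?sb2 ?subnn ?subn0; ring.
Qed.

Lemma kbin_sqr : kbin f sa sb ^+ 2 = emb f ((a * b) *: 'X^2).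
Proof. by rewrite embZ polyCM !embM -sa2 -sb2 /kbin; ring. Qed.

End ScaledFibonacciMatrices.

Theorem theorem3p6 (R : realType) (L : closedFieldType)
    (f : {rmorphism {fraction {poly R}} -> L})
    (f_alg : forall z : L, algebraicOver f z)
    (a b : R) (a_neq0 : a != 0) (b_neq0 : b != 0)
    (sa sb sx : L)
    (sa2 : sa ^+ 2 = emb f a%:P)
    (sb2 : sb ^+ 2 = emb f b%:P)
    (sx2 : sx ^+ 2 = emb f 'X) :
  let r := risingBinom f a b sa sb sx in
  let ax := emb f (a *: 'X) in
  let sqrt_bx := sb * sx in
  [/\ forall n : nat, (1 <= n)%N ->
        r n.+1 = emb f ((a * b) *: 'X^2 + 2%:R) *: r n - r n.-1,
      r 0%N = sqrt_bx *: calF f a b 0 &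
      r 1%N = sqrt_bx *: calF f a b 0 + (ax * sqrt_bx) *: calF f a b 1].
Proof.
move=> r ax sqrt_bx; split.
- case=> // n _ /=.
  rewrite embD {2}/emb !rmorph_nat -(kbin_sqr sa2 sb2).
  exact: binom_transform_rec (calA_rec sx sa2 sb2).
- rewrite /r /risingBinom big_ord1 bin0 expr0 mulr1 scale1r /calA eps_odd /=.
  by rewrite expr0 expr1 mulr1 mulrC.
- rewrite /r /risingBinom big_ord_recl big_ord1 /= bin0 bin1 expr0 expr1.
  rewrite !mul1r scale1r /calA !eps_odd /= scalerA /ax embZ -sa2 /kbin.
  by congr (_ *: _ + _ *: _); rewrite /sqrt_bx; ring.
Qed.
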